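(* Let $m\geq 1$ and $n\geq 0$. For any $u\in\mathbb{N}^n$ let $\varphi_3(u)$ be the word of length $n$ with $\varphi_3(u)_i = u_i+i-1$ for all $1\leq i\leq n$, and let $\varphi_2(u)$ be the word of length $n$ whose first letter (if $n \geq 1$) is $0$ and with $\varphi_2(u)_i = u_i-1$ for $2\leq i\leq n$. Then: (a) $\varphi_3$ is a poset isomorphism from $\mathsf{Hi}_{\mathbf{m}-\mathbf{1}}(n)$ to $\mathcal{I}(\mathsf{Hi}_{\mathbf{m}})(n)$; (b) the identity map is a poset embedding from $\mathcal{I}(\mathsf{Hi}_{\mathbf{m}})(n)$ to $\mathcal{B}(\mathsf{Hi}_{\mathbf{m}+\mathbf{1}})(n)$; (c) $\varphi_2$ is a poset isomorphism from $\mathcal{I}(\mathsf{Hi}_{\mathbf{m}})(n)$ to $\mathcal{O}(\mathsf{Hi}_{\mathbf{m}})(n)$.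
   Context: For an integer $m\geq 0$, $\mathbf{m}$ is the map on positive integers $\mathbf{m}(i)=(i-1)m$; $\mathbf{m}-\mathbf{1}$ and $\mathbf{m}+\mathbf{1}$ are the maps $i\mapsto(i-1)(m-1)$ and $i\mapsto(i-1)(m+1)$. For such a map $\delta$, a $\delta$-cliff of size $n$ is a word $u=u_1\cdots u_n$ of nonnegative integers with $u_i\leq\delta(i)$ for all $i$. $\mathsf{Hi}_\delta(n)$ is the set of $\delta$-cliffs $u$ of size $n$ ($\delta$-hills) with $u_1\leq u_2\leq\cdots\leq u_n$. All sets of words of length $n$ are ordered componentwise. Let $\dim_n(\delta):=\#\{i\in\{1,\dots,n\}:\delta(i)\neq0\}$. The set $\mathcal{I}(\mathsf{Hi}_\delta)(n)$ of input-wings consists of the elements of $\mathsf{Hi}_\delta(n)$ covering exactly $\dim_n(\delta)$ elements in the poset $\mathsf{Hi}_\delta(n)$; the set $\mathcal{O}(\mathsf{Hi}_\delta)(n)$ of output-wings consists of the elements covered by exactly $\dim_n(\delta)$ elements in $\mathsf{Hi}_\delta(n)$; and $\mathcal{B}(\mathsf{Hi}_\delta)(n)=\mathcal{I}(\mathsf{Hi}_\delta)(n)\cap\mathcal{O}(\mathsf{Hi}_\delta)(n)$ is the set of butterflies. These are posets for the componentwise order. A map $\phi$ between posets is a poset embedding if $x\preccurlyeq y\iff\phi(x)\preccurlyeq\phi(y)$; it is a poset isomorphism if it is moreover bijective. *)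

(* Defs.v *)
From mathcomp Require Import all_boot all_order.
From mathcomp Require Import boolp classical_sets functions cardinality.

Import Order.TTheory.

Local Open Scope classical_set_scope.
Local Open Scope card_scope.
Local Open Scope nat_scope.

(* Subsets of a partially ordered type [T] are viewed as posets for the induced
   order. In particular the covering relation is relative to the subset: no
   element of [S] lies strictly between [x] and [y], but elements of [T] may. *)
Definition covers {d : Order.disp_t} {T : porderType d}
    (S : set T) (y x : T) : Prop :=
  [/\ S y, S x, (x < y)%O & forall z : T, S z -> ~ ((x < z)%O /\ (z < y)%O)].

Definition poset_embedding {d : Order.disp_t} {T : porderType d}
    (A B : set T) (f : T -> T) : Prop :=
  set_fun A B f /\
  forall x y : T, A x -> A y -> (x <= y)%O <-> (f x <= f y)%O.

Definition poset_isomorphism {d : Order.disp_t} {T : porderType d}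
    (A B : set T) (f : T -> T) : Prop :=
  poset_embedding A B f /\ set_bij A B f.

(* The canonical order of [n.-tupleprod nat] is the componentwise one. Letters
   are numbered from 0 by ['I_n] while range maps are maps on the positive
   integers, so [tnth u i] is the letter u_(i+1), bounded by [delta i.+1]. *)
Notation word n := (n.-tupleprod nat).

(* The value at [i = 0] is irrelevant. *)
Definition range_map (m : nat) : nat -> nat := fun i => (i - 1) * m.

Definition cliff (delta : nat -> nat) (n : nat) : set (word n) :=
  [set u : word n | forall i : 'I_n, tnth u i <= delta i.+1].

Definition hill (delta : nat -> nat) (n : nat) : set (word n) :=
  [set u : word n | cliff delta n u /\ sorted leq u].

Definition dim (n : nat) (delta : nat -> nat) : nat :=
  #|[pred i : 'I_n | delta i.+1 != 0]|.

Definition input_wing (delta : nat -> nat) (n : nat) : set (word n) :=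
  [set u : word n | hill delta n u /\
    [set v : word n | covers (hill delta n) u v] #= `I_(dim n delta)].

Definition output_wing (delta : nat -> nat) (n : nat) : set (word n) :=
  [set u : word n | hill delta n u /\
    [set v : word n | covers (hill delta n) v u] #= `I_(dim n delta)].

Definition butterfly (delta : nat -> nat) (n : nat) : set (word n) :=
  input_wing delta n `&` output_wing delta n.

Definition phi3 (n : nat) (u : word n) : word n :=
  [tuple tnth u i + i | i < n].

(* The subtraction is truncated, so this is the intended map only on words whose
   letters other than the first are positive. For m >= 1 the input-wings of the
   hills of [range_map m] are such words: they are strictly increasing. *)
Definition phi2 (n : nat) (u : word n) : word n :=
  [tuple if (i : nat) is 0 then 0 else tnth u i - 1 | i < n].

(* Main.v *)
Require Import Defs.
From mathcomp Require Import all_boot all_order.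
From mathcomp Require Import boolp classical_sets functions cardinality.
From mathcomp Require Import zify.

(** A hill covers exactly the hills obtained by lowering one of its letters by
    one: if [v < u] are hills and [i] is the leftmost position where they
    differ, then lowering [u] at [i] keeps it weakly increasing, because the
    letters of [u] to the left of [i] are letters of [v] and so are at most
    [v_i < u_i]; the result lies between [v] and [u]. Symmetrically, a hill is
    covered exactly by the hills obtained by raising one letter by one, as the
    rightmost differing position shows ([covers_decr], [covers_incr]).

    Distinct positions give distinct covers, and a position where [delta]
    vanishes can be neither lowered nor raised. So the number of covers attains
    the dimension iff every position where [delta] does not vanish can be
    lowered (resp. raised): [input_wingP], [output_wingP]. For the range map
    [m >= 1], where [delta] vanishes at the first position only, this makes the
    input-wings the strictly increasing [m]-cliffs, and the output-wings the
    [m]-hills that are strictly increasing from the second letter on and whose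
    letters other than the first are strictly below their bounds.

    With these descriptions all three claims are elementary. Adding [i - 1] to
    the [i]-th letter turns weak increase into strict increase, and the bound
    [(i - 1)(m - 1)] into [(i - 1) m]; it can be undone because consecutive
    letters of a strictly increasing word differ by at least one. A bound
    [(i - 1) m] is strictly below [(i - 1)(m + 1)] when [i >= 2], which gives
    the butterflies. Finally, subtracting one from all letters but the first
    trades the condition of being above the first letter [0] for the
    condition of being strictly below the bound. *)

Import Order.TTheory.
Local Open Scope classical_set_scope.
Local Open Scope card_scope.
Local Open Scope nat_scope.

(** * Words, hills and one-letter modifications *)

(** The alphabet of [word n] is an ordered type that is only convertible to
    [nat]; reading letters at type [nat] itself gives each of them a single
    form for arithmetic. *)
Local Notation letter u i := (@tnth _ nat u i).

Lemma word_leP n (u v : word n) :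
  reflect (forall i, letter u i <= letter v i) (u <= v)%O.
Proof. by rewrite Order.TupleProdOrder.leEtprod; apply: forallP. Qed.

Lemma word_ltP n (u v : word n) :
  reflect ((forall i, letter u i <= letter v i) /\ exists i, letter u i < letter v i)
    (u < v)%O.
Proof.
rewrite Order.TupleProdOrder.ltEtprod.
by apply: (iffP andP) => -[] => [/existsP H /forallP|? /existsP H];
  split=> //; apply/forallP.
Qed.

Lemma hillP delta n (u : word n) :
  hill delta n u <->
  (forall i : 'I_n, letter u i <= delta i.+1) /\
  (forall i j : 'I_n, i < j -> letter u i <= letter u j).
Proof.
split=> -[u_le u_sorted]; split=> //.
  move=> i j lt_ij; rewrite !(tnth_nth 0).
  by apply: (sorted_ltn_nth leq_trans) => //; rewrite inE size_tuple.
apply/(sortedP 0) => k; rewrite size_tuple => lt_kn.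
by have := u_sorted (Ordinal (ltnW lt_kn)) (Ordinal lt_kn) (ltnSn k);
  rewrite !(tnth_nth 0).
Qed.

Definition incr n (u : word n) (i : 'I_n) : word n :=
  [tuple letter u j + (j == i) | j < n].

Definition decr n (u : word n) (i : 'I_n) : word n :=
  [tuple letter u j - (j == i) | j < n].

Lemma decrK n (u : word n) (i : 'I_n) : 0 < letter u i -> incr n (decr n u i) i = u.
Proof.
move=> u_gt0; apply: eq_from_tnth => j; rewrite !tnth_mktuple.
by case: (j =P i) => [->|_] /=; lia.
Qed.

Lemma incr_gt n (u : word n) (i : 'I_n) : (u < incr n u i)%O.
Proof.
apply/word_ltP; split=> [j|]; first by rewrite tnth_mktuple leq_addr.
by exists i; rewrite tnth_mktuple eqxx addn1.
Qed.

Lemma incr_no_between n (u z : word n) (i : 'I_n) :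
  ~ ((u < z)%O /\ (z < incr n u i)%O).
Proof.
move=> [/word_ltP[le_uz [j lt_uz]] /word_ltP[le_zu [k lt_zu]]].
have [ej ek] : j = i /\ k = i.
  move: (le_zu j) (le_uz k) lt_uz lt_zu; rewrite !tnth_mktuple.
  by case: eqP => [->|_]; case: eqP => [->|_] //; lia.
by move: lt_zu lt_uz; rewrite ek ej tnth_mktuple eqxx; lia.
Qed.

(** * Covers in the poset of hills *)

(** Comparing with all positions to the left, not only the previous one, is
    equivalent on hills, and avoids a special case for the first letter. *)
Definition can_lower n (u : word n) (i : 'I_n) : bool :=
  (0 < letter u i) && [forall j : 'I_n, (j < i) ==> (letter u j < letter u i)].

Definition can_raise (delta : nat -> nat) n (u : word n) (i : 'I_n) : bool :=
  (letter u i < delta i.+1) &&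
  [forall j : 'I_n, (i < j) ==> (letter u i < letter u j)].

Lemma can_lowerP n (u : word n) (i : 'I_n) :
  reflect (0 < letter u i /\ forall j : 'I_n, j < i -> letter u j < letter u i)
    (can_lower n u i).
Proof.
by apply: (iffP andP) => -[? H]; split=> //;
  [move=> j; apply/implyP/(forallP H) | apply/forallP => j; apply/implyP/H].
Qed.

Lemma can_raiseP delta n (u : word n) (i : 'I_n) :
  reflect (letter u i < delta i.+1 /\
           forall j : 'I_n, i < j -> letter u i < letter u j)
    (can_raise delta n u i).
Proof.
by apply: (iffP andP) => -[? H]; split=> //;
  [move=> j; apply/implyP/(forallP H) | apply/forallP => j; apply/implyP/H].
Qed.

(** The leftmost position where [v] and [u] differ can be lowered in [u],
    because everything to its left is shared with [v], hence bounded by a letter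
    of [v] smaller than the one of [u]. *)
Lemma covers_decr delta n (u v : word n) : hill delta n u ->
  covers (hill delta n) u v <-> exists2 i, can_lower n u i & decr n u i = v.
Proof.
move=> hill_u; have [u_le u_mono] := iffLR (hillP _ _ _) hill_u.
have hill_decr i : can_lower n u i -> hill delta n (decr n u i).
  move=> /can_lowerP[ui_gt0 ui_gt]; apply/hillP; split=> [j|j k lt_jk];
    rewrite !tnth_mktuple; first by have := u_le j; lia.
  have := u_mono _ _ lt_jk; case: (k =P i) => [ek|_]; last by lia.
  by have := ui_gt j; rewrite -ek => /(_ lt_jk); lia.
have decr_lt i : can_lower n u i -> (decr n u i < u)%O.
  move=> /can_lowerP[ui_gt0 _]; rewrite -{2}(decrK n u i ui_gt0).
  exact: incr_gt.
split=> [[_ hill_v lt_vu no_between]|[i low_i <-]]; last first.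
  split=> //; [exact: hill_decr|exact: decr_lt|move=> z _].
  have /can_lowerP[ui_gt0 _] := low_i; rewrite -{2}(decrK n u i ui_gt0).
  exact: incr_no_between.
have [le_vu [i0 lt_vu0]] := elimT (word_ltP _ _ _) lt_vu.
have [_ v_mono] := iffLR (hillP _ _ _) hill_v.
case: (@arg_minnP _ i0 (fun i => letter v i < letter u i) val lt_vu0) => i lt_i min_i.
(* By minimality of [i], the words [u] and [v] agree before [i]. *)
have low_i : can_lower n u i.
  apply/can_lowerP; split=> [|j lt_ji]; first exact: leq_ltn_trans lt_i.
  have := v_mono _ _ lt_ji; have := min_i j; have := le_vu j.
  by move: lt_i lt_ji => /=; lia.
exists i => //; apply/eqP; apply: contraT => ne_v; exfalso.
apply: (no_between (decr n u i) (hill_decr _ low_i)); split; last exact: decr_lt.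
rewrite lt_neqAle eq_sym ne_v; apply/word_leP => j; rewrite tnth_mktuple.
by have := le_vu j; case: (j =P i) => [->|_]; lia.
Qed.

(** Dually, the rightmost position where [u] and [v] differ can be raised in [u];
    the bound imposed by [delta] is respected since [v] respects it. *)
Lemma covers_incr delta n (u v : word n) : hill delta n u ->
  covers (hill delta n) v u <->
  exists2 i, can_raise delta n u i & incr n u i = v.
Proof.
move=> hill_u; have [u_le u_mono] := iffLR (hillP _ _ _) hill_u.
have hill_incr i : can_raise delta n u i -> hill delta n (incr n u i).
  move=> /can_raiseP[ui_lt ui_next]; apply/hillP; split=> [j|j k lt_jk];
    rewrite !tnth_mktuple.
    by have := u_le j; case: (j =P i) => [->|_]; lia.
  have := u_mono _ _ lt_jk; case: (j =P i) => [ej|_]; last by lia.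
  by have := ui_next k; rewrite -ej => /(_ lt_jk); lia.
split=> [[hill_v _ lt_uv no_between]|[i up_i <-]]; last first.
  split=> //; [exact: hill_incr|exact: incr_gt|move=> z _].
  exact: incr_no_between.
have [le_uv [i0 lt_uv0]] := elimT (word_ltP _ _ _) lt_uv.
have [v_le v_mono] := iffLR (hillP _ _ _) hill_v.
case: (@arg_maxnP _ i0 (fun i => letter u i < letter v i) val lt_uv0) => i lt_i max_i.
have up_i : can_raise delta n u i.
  apply/can_raiseP; split=> [|j lt_ij]; first exact: leq_trans (v_le i).
  have := v_mono _ _ lt_ij; have := max_i j; have := le_uv j.
  by move: lt_i lt_ij => /=; lia.
exists i => //; apply/eqP; apply: contraT => ne_v; exfalso.
apply: (no_between (incr n u i) (hill_incr _ up_i)); split; first exact: incr_gt.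
rewrite lt_neqAle ne_v; apply/word_leP => j; rewrite tnth_mktuple.
by have := le_uv j; move: lt_i; case: (j =P i) => [->|_]; lia.
Qed.

(** * Wings as hills with the maximal number of covers *)

Lemma card_image_pred (I : finType) (U : Type) (P : pred I) (f : I -> U) :
  {in P &, injective f} -> [set y | exists2 i, P i & f i = y] #= `I_#|P|.
Proof.
move=> f_inj; pose g (k : 'I_#|P|) := f (enum_val k).
have -> : [set y | exists2 i, P i & f i = y] = g @` [set: 'I_#|P|].
  apply/seteqP; split=> [y [i Pi <-]|y [k _ <-]]; last first.
    by exists (enum_val k) => //; have := enum_valP k.
  by exists (enum_rank_in Pi i); rewrite // /g enum_rankK_in.
apply: (card_eq_trans _ (card_esym card_II)).
apply: inj_card_eq => k l _ _ /f_inj eq_kl.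
by apply: enum_val_inj; apply: eq_kl; apply: enum_valP.
Qed.

(** This turns a condition on the number of covers into one on positions: the
    predicate [P] selects those giving a cover, and [Q] those counted by the
    dimension. *)
Lemma card_image_pred_full (I : finType) (U : Type) (P Q : pred I) (f : I -> U) :
  {in P &, injective f} -> subpred P Q ->
  [set y | exists2 i, P i & f i = y] #= `I_#|Q| <-> subpred Q P.
Proof.
move=> f_inj sPQ; have cardP := card_image_pred _ _ _ _ f_inj.
have PQ : P \subset Q by apply/fintype.subsetP => i; apply: sPQ.
split=> [cardQ|sQP].
  apply/fintype.subsetP; rewrite -(subset_leqif_card PQ).
  apply/eqP/card_eq_II; exact: card_eq_trans (card_esym cardP) cardQ.
have -> : #|Q| = #|P|; last by [].
by apply: eq_card => i; apply/idP/idP; [apply: sQP|apply: sPQ].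
Qed.

(** A position that can be lowered carries a positive letter, so [delta] does not
    vanish there; the dimension is thus an upper bound on the number of covers,
    reached iff no such position is missed. *)
Lemma input_wingP delta n (u : word n) :
  input_wing delta n u <->
  hill delta n u /\ forall i : 'I_n, delta i.+1 != 0 -> can_lower n u i.
Proof.
rewrite /input_wing /=; split=> -[hill_u H]; split=> //; move: H;
  have -> : [set v | covers (hill delta n) u v] =
      [set v | exists2 i, can_lower n u i & decr n u i = v]
    by apply/funext => v; apply/propext; apply: covers_decr.
all: have [u_le _] := iffLR (hillP _ _ _) hill_u;
  rewrite card_image_pred_full //.
1, 3: move=> i j /can_lowerP[ui _] /can_lowerP[uj _]
    /(congr1 (fun v : word n => letter v i));
  by rewrite !tnth_mktuple eqxx; case: eqP => //; lia.
all: by move=> i /can_lowerP[ui _] /=; have := u_le i; lia.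
Qed.

Lemma output_wingP delta n (u : word n) :
  output_wing delta n u <->
  hill delta n u /\ forall i : 'I_n, delta i.+1 != 0 -> can_raise delta n u i.
Proof.
rewrite /output_wing /=; split=> -[hill_u H]; split=> //; move: H;
  have -> : [set v | covers (hill delta n) v u] =
      [set v | exists2 i, can_raise delta n u i & incr n u i = v]
    by apply/funext => v; apply/propext; apply: covers_incr.
all: rewrite card_image_pred_full //.
1, 3: move=> i j _ _ /(congr1 (fun v : word n => letter v i));
  by rewrite !tnth_mktuple eqxx; case: eqP => //; lia.
all: by move=> i /can_raiseP[ui _] /=; lia.
Qed.

(** * Wings for arithmetic range maps *)

Lemma range_map_neq0 m i : 0 < m -> (range_map m i.+1 != 0) = (0 < i).
Proof. by rewrite /range_map subn1 muln_eq0 negb_or -!lt0n => ->; rewrite andbT. Qed.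

(** Positivity of the letters other than the first, part of the possibility of
    lowering them, comes for free from being above the first letter. *)
Lemma input_wing_range_mapP m n (u : word n) : 0 < m ->
  input_wing (range_map m) n u <->
  (forall i : 'I_n, letter u i <= i * m) /\
  (forall i j : 'I_n, i < j -> letter u i < letter u j).
Proof.
move=> m_gt0; rewrite input_wingP hillP /range_map; split.
  move=> [[u_le u_mono] low]; split=> [i|i j lt_ij].
    by have := u_le i; rewrite subn1.
  have := low j; rewrite -/(range_map m j.+1) range_map_neq0 //.
  by move=> /(_ (leq_ltn_trans (leq0n i) lt_ij)) /can_lowerP[_]; apply.
move=> [u_le u_mono]; split; first split=> [i|i j /u_mono/ltnW //].
  by have := u_le i; rewrite subn1.
move=> i; rewrite -/(range_map m i.+1) range_map_neq0 // => i_gt0.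
apply/can_lowerP; split=> [|j]; last exact: u_mono.
have n_gt0 : 0 < n by apply: leq_ltn_trans (ltn_ord i).
exact: leq_ltn_trans (u_mono (Ordinal n_gt0) i i_gt0).
Qed.

(** The first letter is [0] and cannot be raised, hence it may equal the second
    one: strict increase is only required from the second letter on. *)
Lemma output_wing_range_mapP m n (u : word n) : 0 < m ->
  output_wing (range_map m) n u <->
  [/\ forall i : 'I_n, letter u i <= i * m,
      forall i : 'I_n, 0 < i -> letter u i < i * m
    & forall i j : 'I_n, 0 < i -> i < j -> letter u i < letter u j].
Proof.
move=> m_gt0; rewrite output_wingP hillP; split.
  move=> [[u_le u_mono] up].
  have up' (i : 'I_n) : 0 < i -> can_raise (range_map m) n u i.
    by move=> i_gt0; apply: up; rewrite range_map_neq0.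
  split=> [i|i /up'|i j /up']; first by have := u_le i; rewrite /range_map subn1.
    by move=> /can_raiseP[]; rewrite /range_map subn1.
  by move=> /can_raiseP[_]; apply.
move=> [u_le u_lt u_mono]; split; first split=> [i|i j lt_ij].
- by rewrite /range_map subn1.
- have [i0|/u_mono/(_ lt_ij)/ltnW //] := posnP i.
  by have := u_le i; rewrite i0 mul0n leqn0 => /eqP ->.
move=> i; rewrite range_map_neq0 // => i_gt0; apply/can_raiseP.
by split=> [|j]; [rewrite /range_map subn1; apply: u_lt|apply: u_mono].
Qed.

Lemma increasing_gap n (u : word n) :
  (forall i j : 'I_n, i < j -> letter u i < letter u j) ->
  forall i j : 'I_n, i <= j -> letter u i + (j - i) <= letter u j.
Proof.
move=> u_mono i [j lt_jn]; elim: j lt_jn => [|j IHj] lt_jn /=.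
  rewrite leqn0 => /eqP i0; rewrite i0 addn0.
  by have -> : i = Ordinal lt_jn by apply: val_inj.
rewrite leq_eqVlt => /predU1P[ij|lt_ij].
  have -> : i = Ordinal lt_jn by apply: val_inj.
  by rewrite subnn addn0.
have := IHj (ltnW lt_jn) lt_ij.
have := u_mono (Ordinal (ltnW lt_jn)) (Ordinal lt_jn) (ltnSn j).
by move: lt_ij => /=; lia.
Qed.

(** This makes the truncated subtractions in the inverse of [phi3] and in [phi2]
    genuine on strictly increasing words. *)
Lemma increasing_ge_index n (u : word n) :
  (forall i j : 'I_n, i < j -> letter u i < letter u j) ->
  forall i : 'I_n, i <= letter u i.
Proof.
move=> u_mono i; have n_gt0 : 0 < n by apply: leq_ltn_trans (ltn_ord i).
by have := increasing_gap n u u_mono (Ordinal n_gt0) i (leq0n i) => /=; lia.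
Qed.

(** * The three maps *)

Lemma poset_embedding_inj {d : Order.disp_t} {T : porderType d}
    (A B : set T) (f : T -> T) : poset_embedding A B f -> set_inj A f.
Proof.
move=> [_ f_le] x y; rewrite !inE => Ax Ay eq_f; apply/eqP.
rewrite eq_le; apply/andP; split; first by apply/f_le => //; rewrite eq_f.
by apply/f_le => //; rewrite eq_f.
Qed.

Lemma poset_isomorphism_of_surj {d : Order.disp_t} {T : porderType d}
    (A B : set T) (f : T -> T) :
  poset_embedding A B f -> set_surj A B f -> poset_isomorphism A B f.
Proof.
move=> f_emb f_surj; split=> //; split=> //; first by case: f_emb.
exact: poset_embedding_inj f_emb.
Qed.

Lemma phi3E n (u : word n) (i : 'I_n) : letter (phi3 n u) i = letter u i + i.
Proof. by rewrite tnth_mktuple. Qed.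

Lemma phi3_isomorphism m n : 0 < m ->
  poset_isomorphism (hill (range_map (m - 1)) n) (input_wing (range_map m) n)
    (phi3 n).
Proof.
move=> m_gt0; apply: poset_isomorphism_of_surj; first split.
- move=> u /hillP[u_le u_mono]; apply/input_wing_range_mapP => //.
  split=> [i|i j lt_ij]; rewrite !phi3E; last first.
    by have := u_mono _ _ lt_ij; lia.
  by have := u_le i; rewrite /range_map; nia.
- move=> u v _ _; split=> /word_leP le_uv; apply/word_leP => i; move: (le_uv i);
    by rewrite !phi3E leq_add2r.
move=> u /(input_wing_range_mapP _ _ _ m_gt0)[u_le u_mono].
(* The inverse of [phi3]; [increasing_gap] makes it weakly increasing. *)
exists [tuple letter u i - i | i < n].
  apply/hillP; split=> [i|i j lt_ij]; rewrite !tnth_mktuple.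
    by have := u_le i; rewrite /range_map; nia.
  by have := increasing_gap _ _ u_mono _ _ (ltnW lt_ij); lia.
apply: eq_from_tnth => i; rewrite phi3E tnth_mktuple subnK //.
exact: increasing_ge_index.
Qed.

Lemma input_wing_butterfly m n : 0 < m ->
  poset_embedding (input_wing (range_map m) n)
    (butterfly (range_map (m + 1)) n) id.
Proof.
move=> m_gt0; split=> // u /(input_wing_range_mapP _ _ _ m_gt0)[u_le u_mono].
have m1_gt0 : 0 < m + 1 by rewrite addn1.
split; [apply/input_wing_range_mapP|apply/output_wing_range_mapP] => //.
  by split=> // i; have := u_le i; nia.
split=> [i|i i_gt0|i j _]; last exact: u_mono.
  by have := u_le i; nia.
by have := u_le i; nia.
Qed.

Lemma phi2E n (u : word n) (i : 'I_n) :
  letter (phi2 n u) i = if i == 0 :> nat then 0 else letter u i - 1.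
Proof. by rewrite tnth_mktuple; case: i => -[]. Qed.

Lemma phi2_isomorphism m n : 0 < m ->
  poset_isomorphism (input_wing (range_map m) n) (output_wing (range_map m) n)
    (phi2 n).
Proof.
move=> m_gt0; apply: poset_isomorphism_of_surj; first split.
- move=> u /(input_wing_range_mapP _ _ _ m_gt0)[u_le u_mono].
  have u_ge := increasing_ge_index _ _ u_mono.
  apply/output_wing_range_mapP => //.
  split=> [i|i i_gt0|i j i_gt0 lt_ij]; rewrite !phi2E.
  + by have := u_le i; case: ifP => //; lia.
  + by have := u_le i; have := u_ge i; rewrite gtn_eqF //; lia.
  have := u_mono _ _ lt_ij; have := u_ge i.
  by rewrite !gtn_eqF //; [lia|exact: ltn_trans lt_ij].
- move=> u v /(input_wing_range_mapP _ _ _ m_gt0)[u_le u_mono].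
  move=> /(input_wing_range_mapP _ _ _ m_gt0)[v_le v_mono].
  have u_ge := increasing_ge_index _ _ u_mono.
  have v_ge := increasing_ge_index _ _ v_mono.
  split=> /word_leP le_uv; apply/word_leP => i; move: (le_uv i); rewrite !phi2E.
    by case: ifP => // _; apply: leq_sub2r.
  case: eqP => [i0 _|]; last by have := u_ge i; have := v_ge i; lia.
  by have := u_le i; rewrite i0; lia.
move=> v /(output_wing_range_mapP _ _ _ m_gt0)[v_le v_lt v_mono].
(* The inverse of [phi2]: the room left below the bounds lets every letter but
   the first be raised. *)
exists [tuple if i == 0 :> nat then 0 else letter v i + 1 | i < n].
  apply/input_wing_range_mapP => //; split=> [i|i j lt_ij];
    rewrite !tnth_mktuple.
    by have [//|i_gt0] := posnP i; have := v_lt i i_gt0; lia.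
  rewrite (gtn_eqF (leq_ltn_trans _ lt_ij)) //.
  by have [_|i_gt0] := posnP i; [lia|have := v_mono _ _ i_gt0 lt_ij; lia].
apply: eq_from_tnth => i; rewrite phi2E tnth_mktuple.
case: eqP => [i0|_]; last by rewrite addnK.
by have := v_le i; rewrite i0 mul0n leqn0 => /eqP/esym.
Qed.

Theorem theorem2p2p5 (m n : nat) (m_ge1 : (1 <= m)%N) :
  [/\ poset_isomorphism (hill (range_map (m - 1)) n)
        (input_wing (range_map m) n) (phi3 n),
      poset_embedding (input_wing (range_map m) n)
        (butterfly (range_map (m + 1)) n) id
    & poset_isomorphism (input_wing (range_map m) n)
        (output_wing (range_map m) n) (phi2 n)].
Proof.
split; [exact: phi3_isomorphism|exact: input_wing_butterfly|].
exact: phi2_isomorphism.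
Qed.
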